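(* Let $\mathcal{C}=(S,\Delta,r)$ be a semimatroid with a fixed linear order on $S$. Then $\Delta$ collapses onto $BC(\mathcal{C})$ via a sequence of simplicial collapses. Moreover, $P(r;q,x)=\sum_{\sigma\in BC(\mathcal{C})}(qx)^{|\sigma|}$ and $P(\Delta;q)=\sum_{\sigma\in CBC(\mathcal{C})}q^{|\sigma|}$.
   Context: A semimatroid is a triple $(S,\Delta,r)$ with $S$ finite, $\Delta$ a non-void simplicial complex over $S$, and $r:\Delta\to\mathbb{N}$ such that for all $\sigma,\tau\in\Delta$: (i) $0\le r(\sigma)\le|\sigma|$; (ii) $\sigma\subseteq\tau\Rightarrow r(\sigma)\le r(\tau)$; (iii) if $\sigma\cup\tau\in\Delta$ then $r(\sigma)+r(\tau)\ge r(\sigma\cup\tau)+r(\sigma\cap\tau)$; (iv) if $r(\sigma)=r(\sigma\cap\tau)$ then $\sigma\cup\tau\in\Delta$; (v) if $r(\sigma)<r(\tau)$ there is $y\in\tau\setminus\sigma$ with $\sigma\cup\{y\}\in\Delta$. A face $X$ is dependent if $r(X)<|X|$, independent otherwise; circuits are minimal dependent faces; bases are maximal independent faces. A broken circuit is $\sigma\setminus\{\min\sigma\}$ for a circuit $\sigma$; a no-broken circuit is a face containing no broken circuit, and $BC(\mathcal{C})$ is the complex of no-broken circuits. A no-broken circuit $\sigma$ is critical if for every $x\in\sigma$ there exists $y<x$ such that $(\sigma\setminus\{x\})\cup\{y\}$ is a no-broken circuit; $CBC(\mathcal{C})$ is the set of critical no-broken circuits that are bases. For monotone $f:\Delta\to\mathbb{N}$,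 with $\Delta_{\le j}=\{\sigma:f(\sigma)\le j\}$, $\Delta_{<j}=\{\sigma: f(\sigma)<j\}$ and $\widetilde\beta_i$ the relative reduced Betti numbers (augmented chain complexes with the empty face in degree $-1$, over a fixed field), the Poincaré polynomial is $P(f;q,x)=\sum_{i\ge-1,j\ge0}\widetilde\beta_i(\Delta_{\le j},\Delta_{<j})x^jq^{i+1}$; $P(\Delta;q)=\sum_{i\ge -1}\widetilde\beta_i(\Delta)q^{i+1}$. Here $P(r;q,x)$ uses the rank function $f=r$.
   Formalization: In the definition of a critical no-broken circuit σ, the element y < x exchanged for x is required to lie outside σ; if y in σ were allowed, the formula for P(Δ;q) would fail, e.g. for the 4-cycle 13, 14, 23, 24 with r equal to cardinality. *)

(* Defs.v *)
From HB Require Import structures.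
From mathcomp Require Import all_boot all_order all_algebra.

Set Implicit Arguments.
Unset Strict Implicit.
Unset Printing Implicit Defensive.

Import GRing.Theory.
Local Open Scope ring_scope.

(* Abstract simplicial complexes are downward closed sets K : {set {set T}}.
   The void complex is set0; it differs from the complex [set set0], whose only
   face is the empty one. *)
Section Semimatroids.

Variable T : finType.
Implicit Types (K L : {set {set T}}) (s t : {set T}).

Definition simplicial_complex K : Prop :=
  forall s t, t \in K -> s \subset t -> s \in K.

(* The rank function is total, but its values outside [faces] are never used. *)
Record semimatroid := Semimatroid {
  faces : {set {set T}};
  rk : {set T} -> nat;
  faces_nonvoid : faces != set0;
  faces_complex : simplicial_complex faces;
  rk_le_card : forall s, s \in faces -> (rk s <= #|s|)%N;
  rk_mono : forall s t, s \in faces -> t \in faces -> s \subset t ->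
    (rk s <= rk t)%N;
  rk_submod : forall s t, s \in faces -> t \in faces -> s :|: t \in faces ->
    (rk (s :|: t) + rk (s :&: t) <= rk s + rk t)%N;
  faces_union : forall s t, s \in faces -> t \in faces ->
    rk s = rk (s :&: t) -> s :|: t \in faces;
  faces_exchange : forall s t, s \in faces -> t \in faces -> (rk s < rk t)%N ->
    exists2 y, y \in t :\: s & y |: s \in faces }.

Section Circuits.

Variable C : semimatroid.

Definition dependent s : bool := (s \in faces C) && (rk C s < #|s|)%N.

Definition independent s : bool := (s \in faces C) && ~~ dependent s.

Definition circuit s : bool := minset dependent s.

Definition basis s : bool := maxset independent s.

End Circuits.

(* The free face s may be empty: the complex [set set0; [set x]] collapses onto
   the void complex. This is needed when the semimatroid has a loop x, because
   set0 is then a broken circuit and there are no no-broken circuits. *)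
Definition elementary_collapse K L : bool :=
  [exists s in K, exists t in K,
    [&& #|t| == #|s|.+1, [set u in K | s \proper u] == [set t]
      & L == K :\ s :\ t]].

Definition collapses K L : bool := connect elementary_collapse K L.

End Semimatroids.

Section BrokenCircuits.

Variables (d : Order.disp_t) (S : finOrderType d) (C : semimatroid S).
Implicit Types s t : {set S}.

Definition broken_circuit t : bool :=
  [exists s : {set S}, exists m in s,
    [&& circuit C s, [forall y in s, (m <= y)%O] & t == s :\ m]].

Definition BC : {set {set S}} :=
  [set s in faces C | [forall t : {set S}, broken_circuit t ==> ~~ (t \subset s)]].

(* The element y is exchanged for x, so it lies outside s. If y were allowed in
   s, then y |: (s :\ x) = s :\ x would be a face of BC whenever s is, and the
   condition would be void for every x other than the minimum of s. *)
Definition critical s : bool :=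
  [forall x in s, exists y,
    [&& (y < x)%O, y \notin s & y |: (s :\ x) \in BC]].

Definition CBC : {set {set S}} := [set s in BC | critical s & basis C s].

End BrokenCircuits.

Section Homology.

Variables (F : fieldType) (d : Order.disp_t) (S : finOrderType d).
Implicit Types (K L : {set {set S}}) (s : {set S}).

(* All chains, in all degrees, on the full simplex over S. *)
Definition chain : vectType F := {ffun {set S} -> F^o}.

Definition simplex_chain s : chain := [ffun t => (t == s)%:R].

(* The simplices are oriented by the order on S; the exponent is the position
   of x in the increasing enumeration of s. *)
Definition simplex_boundary s : chain :=
  \sum_(x in s) (-1) ^+ #|[set y in s | (y < x)%O]| *: simplex_chain (s :\ x).

Definition boundary_fun (c : chain) : chain :=
  \sum_(s : {set S}) (c s : F) *: simplex_boundary s.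

Fact boundary_fun_is_linear : linear boundary_fun.
Proof.
move=> a u v; rewrite /boundary_fun scaler_sumr -big_split /=.
by apply: eq_bigr => s _; rewrite !ffunE scalerDl scalerA.
Qed.

HB.instance Definition _ :=
  GRing.isLinear.Build F chain chain *:%R boundary_fun boundary_fun_is_linear.

Definition boundary : 'End(chain) := linfun boundary_fun.

(* Chains on K of simplices with k vertices, that is, of dimension k - 1. *)
Definition chains K (k : nat) : {vspace chain} :=
  <<[seq simplex_chain s | s in [set s in K | #|s| == k]]>>%VS.

(* The chains c on K with boundary c in L; they contain the chains on L. For
   k = 0 the condition holds because the boundary of the empty simplex is 0. *)
Definition rel_cycles K L (k : nat) : {vspace chain} :=
  (chains K k :&: boundary @^-1: chains L k.-1)%VS.

Definition rel_boundaries K L (k : nat) : {vspace chain} :=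
  (boundary @: chains K k.+1 + chains L k)%VS.

(* The relative reduced Betti number in degree k - 1 of complexes L \subset K:
   the dimension of rel_cycles / rel_boundaries. *)
Definition rbetti K L (k : nat) : nat :=
  (\dim (rel_cycles K L k) - \dim (rel_boundaries K L k))%N.

Lemma chains_large K k : (#|S| < k)%N -> chains K k = 0%VS.
Proof.
move=> lt_Sk; rewrite /chains; apply/eqP; rewrite -subv0; apply/span_subvP => c.
case/imageP => s; rewrite inE => /andP[_ /eqP sk] _.
by have := max_card (mem s); rewrite sk leqNgt lt_Sk.
Qed.

Lemma rbetti_large K L k : (#|S| < k)%N -> rbetti K L k = 0%N.
Proof.
by move=> lt_Sk; rewrite /rbetti /rel_cycles chains_large // cap0v dimv0.
Qed.

Lemma rbetti_same K k : rbetti K K k = 0%N.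
Proof.
apply/eqP; rewrite subn_eq0 dimvS //.
exact: subv_trans (capvSl _ _) (addvSr _ _).
Qed.

Definition sublevel K (f : {set S} -> nat) (j : nat) : {set {set S}} :=
  [set s in K | (f s <= j)%N].

Definition strict_sublevel K (f : {set S} -> nat) (j : nat) : {set {set S}} :=
  [set s in K | (f s < j)%N].

Lemma rbetti_sublevel_large K (f : {set S} -> nat) j k :
  (\max_(s in K) f s < j)%N ->
  rbetti (sublevel K f j) (strict_sublevel K f j) k = 0%N.
Proof.
move=> lt_j; rewrite -[RHS](rbetti_same (sublevel K f j) k).
congr rbetti; apply/setP => s; rewrite !inE.
case: (boolP (s \in K)) => //= sK.
have lt_fs := leq_ltn_trans (@leq_bigmax_cond _ (mem K) f s sK) lt_j.
by rewrite lt_fs ltnW.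
Qed.

(* In {poly {poly int}}, 'X stands for q and 'X%:P for x. By the lemmas above,
   the omitted terms of the series vanish. *)
Definition poincare_fun K (f : {set S} -> nat) : {poly {poly int}} :=
  \sum_(k < #|S|.+1) \sum_(j < (\max_(s in K) f s).+1)
    (rbetti (sublevel K f j) (strict_sublevel K f j) k)%:R
      *: ('X%:P ^+ j * 'X ^+ k).

Definition poincare K : {poly int} :=
  \sum_(k < #|S|.+1) (rbetti K set0 k)%:R *: 'X ^+ k.

End Homology.

(* Main.v *)
Require Import Defs.
From mathcomp Require Import all_boot all_order all_algebra zify.

(* Call [m] spanned by a face [s] if adding it to [s] gives a face of the same
   rank. A face is in BC iff no [m] is spanned by the elements of the face larger
   than [m]. In a face outside BC, toggle the least such [m]: this is an acyclic
   matching of faces \ BC that preserves the rank, so the faces collapse onto BC,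
   and in the relative complex of rank [j] the unmatched faces are the members of
   BC of rank [j], all of cardinality [j].
   On BC, let B(s) be the basis of least weight containing [s], where the weight
   of a basis is the sum of the positions of its elements. It lies in BC, and it
   is the only basis B containing [s] such that [s] contains every [x] in B that
   can be exchanged for a smaller element. Toggling the least nonexchangeable
   element of B(s) is an acyclic matching whose unmatched faces are the critical
   bases.
   In both cases all unmatched faces have the same cardinality, so the Morse
   inequalities determine the Betti numbers. *)

Set Implicit Arguments.
Unset Strict Implicit.
Unset Printing Implicit Defensive.

Import GRing.Theory Order.TTheory.

(** * Acyclic matchings *)

Section Matching.

Variable T : finType.
Implicit Types (K D : {set {set T}}) (s t u : {set T}).

(* A face [s] is matched with its symmetric difference with [e s], which is a
   singleton (a set, because there need not be any function into an empty [T]).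
   The potential [phi] rules out alternating cycles. *)
Definition acyclic_matching D (e : {set T} -> {set T}) (phi : {set T} -> nat) :=
  (forall s, s \in D -> [/\ #|e s| = 1, s :\: e s \in D, s :|: e s \in D
                         & phi (s :\: e s) = phi (s :|: e s)])
  /\ {in D &, forall s t, s \subset t ->
       (phi s <= phi t) /\ (phi s = phi t -> e s = e t)}.

Section Theory.

Variables (D : {set {set T}}) (e : {set T} -> {set T}) (phi : {set T} -> nat).
Hypothesis mD : acyclic_matching D e phi.

(** By monotonicity [phi s] lies between the potentials of [s :\: e s] and [s :|: e s]. These agree,
    so all three are equal and [e] is constant on the pair. *)
Lemma matching_down s : s \in D ->
  [/\ s :\: e s \in D, phi (s :\: e s) = phi s & e (s :\: e s) = e s].
Proof.
move=> sD; have [_ dD uD phiE] := mD.1 s sD.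
have [le1 e1] := mD.2 _ _ dD sD (subsetDl _ _).
have [le2 _] := mD.2 _ _ sD uD (subsetUl _ _).
have E : phi (s :\: e s) = phi s by apply/eqP; rewrite eqn_leq le1 phiE le2.
by split=> //; apply: e1.
Qed.

Lemma matching_up s : s \in D ->
  [/\ s :|: e s \in D, phi (s :|: e s) = phi s & e (s :|: e s) = e s].
Proof.
move=> sD; have [_ _ uD phiE] := mD.1 s sD.
have [_ E _] := matching_down sD.
have [le2 e2] := mD.2 _ _ sD uD (subsetUl _ _).
have E' : phi (s :|: e s) = phi s by rewrite -phiE.
by split=> //; apply/esym/e2.
Qed.

Lemma matching_singleton s : s \in D -> exists x, e s = [set x].
Proof. by move=> /(proj1 mD)[/eqP/cards1P]. Qed.

Lemma matching_restrict D' : D' \subset D ->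
  (forall s, s \in D' -> s :\: e s \in D' /\ s :|: e s \in D') ->
  acyclic_matching D' e phi.
Proof.
move=> /subsetP sub cl; split=> [s sD'|s t sD' tD']; last first.
  by apply: (proj2 mD); apply: sub.
by have [-> _ _ ->] := proj1 mD s (sub s sD'); have [-> ->] := cl s sD'.
Qed.

End Theory.

(** Shifting [phi2] above every value of [phi1] makes potentials differ across the two parts; the
    last hypothesis excludes the inclusions that would decrease the potential. *)
Lemma matching_cat D1 D2 e1 e2 phi1 phi2 :
    acyclic_matching D1 e1 phi1 -> acyclic_matching D2 e2 phi2 ->
    [disjoint D1 & D2] ->
    {in D1 & D2, forall s t, ~~ (t \subset s)} ->
  exists e phi, acyclic_matching (D1 :|: D2) e phi.
Proof.
move=> m1 m2 dis up; pose N := (\max_(s in D1) phi1 s).+1.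
exists (fun s => if s \in D1 then e1 s else e2 s).
exists (fun s => if s \in D1 then phi1 s else N + phi2 s).
have D2N s : s \in D2 -> s \in D1 = false.
  by move=> sD2; apply: contraTF sD2 => /(disjointFr dis) ->.
have ltN s : s \in D1 -> (phi1 s < N).
  by move=> sD1; rewrite ltnS (@leq_bigmax_cond _ (mem D1) phi1 s).
split=> [s|s t]; rewrite !inE.
  case: (boolP (s \in D1)) => [sD1 _|_ /= sD2].
    by have [-> dD uD ->] := proj1 m1 s sD1; rewrite dD uD.
  by have [-> dD uD ->] := proj1 m2 s sD2; rewrite dD uD !orbT !D2N.
case: (boolP (s \in D1)) => [sD1 _|_ /= sD2];
  case: (boolP (t \in D1)) => [tD1 _|_ /= tD2] st.
- exact: (proj2 m1).
- by have := ltN s sD1; split; lia.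
- by case/negP: (up t s tD1 sD2).
- have [le eqe] := proj2 m2 s t sD2 tD2 st; split; first by rewrite leq_add2l.
  by move/addnI.
Qed.

(* A lower cell of the matching that maximizes [phi s + #|s|] is a free face. *)
Lemma matching_collapses K D e phi :
    simplicial_complex K -> D \subset K -> simplicial_complex (K :\: D) ->
    acyclic_matching D e phi -> collapses K (K :\: D).
Proof.
have [n] := ubnP #|D|; elim: n K D => // n IHn K D ltDn cK subDK cKD mD.
have [->|[s0 s0D]] := set_0Vmem D; first by rewrite setD0; apply: connect0.
pose P := [pred s in D | [disjoint e s & s]].
have Ps0 : P (s0 :\: e s0).
  have [dD _ eE] := matching_down mD s0D; rewrite /= dD eE.
  by rewrite disjoint_sym disjoints_subset subDset setUCr subsetT.
case: (@arg_maxnP _ (s0 :\: e s0) P (fun s => phi s + #|s|)) => // s.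
move=> /andP[sD sdis] smax; have [x ex] := matching_singleton mD sD.
have xNs : x \notin s by move: sdis; rewrite ex disjoints1.
have [tD phit et] := matching_up mD sD; set t := s :|: e s in tD phit et.
have tE : t = x |: s by rewrite /t ex setUC.
(* A face [u] above [s] lies in [D], since [K :\: D] is a complex. Maximality gives
   [phi u + #|u| - 1 <= phi s + #|s|], while [phi s <= phi u] and [#|s| < #|u|]. Both bounds are
   thus tight, so [e u = e s] and [u] is the partner of [s]. *)
have up u : u \in K -> s \subset u -> u != s -> u = t.
  move=> uK su nus.
  have uD : u \in D.
    apply: contraR nus => uND; have := cKD s u; rewrite !inE uND sD uK /=.
    by move=> /(_ isT su).
  have [le eqe] := proj2 mD s u sD uD su.
  have [dD phid ed] := matching_down mD uD.
  have Pd : P (u :\: e u).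
    by rewrite /= dD ed disjoint_sym disjoints_subset subDset setUCr subsetT.
  have := smax _ Pd; rewrite phid.
  have ltc : (#|s| < #|u|).
    by rewrite proper_card // properEneq eq_sym nus.
  have [y ey] := matching_singleton mD uD.
  have le1 : (#|u| <= #|u :\: e u|.+1).
    by rewrite ey (cardsD1 y u); case: (y \in u).
  move=> max1; have eqphi : phi s = phi u.
    by move: max1 ltc le1 le; rewrite /=; clear; lia.
  have ey' := eqe eqphi; rewrite ex ey in ey'; move/set1_inj: ey' => yx.
  have sud : s \subset u :\ x by rewrite subsetD1 su xNs.
  have /eqP sE : s == u :\ x.
    by rewrite eqEcard sud yx -ey; move: max1; rewrite eqphi /=; clear; lia.
  have xu : x \in u.
    apply: contraR nus => xNu; rewrite sE; apply/eqP/setP => z; rewrite !inE.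
    by case: eqP => [->|]; rewrite ?(negPf xNu).
  by rewrite tE sE setD1K.
have tK : t \in K := subsetP subDK _ tD.
have sK : s \in K := subsetP subDK _ sD.
have ts : t != s by apply: contraNneq xNs => <-; rewrite tE setU11.
apply: (@connect_trans _ _ (K :\ s :\ t)).
  apply: connect1; apply/existsP; exists s; rewrite sK; apply/existsP; exists t.
  rewrite tK eqxx andbT /= tE cardsU1 xNs eqxx -tE /=.
  apply/eqP/setP => u; rewrite !inE; apply/andP/eqP => [[uK /andP[su nus]]|->].
    by apply: up => //; apply: contraNneq nus => ->.
  by rewrite tK properEneq eq_sym ts subsetUl.
have eqKD : K :\: D = (K :\ s :\ t) :\: (D :\ s :\ t).
  apply/setP => u; rewrite !inE.
  by case: eqP => [->|]; case: eqP => [->|] //=; rewrite ?sD ?tD.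
have tDs : t \in D :\ s by rewrite !inE ts tD.
have backst u : u \in D -> u :\ x = s -> (u == s) || (u == t).
  move=> uD us; case: (boolP (x \in u)) => xu.
    by rewrite tE -us setD1K // eqxx orbT.
  apply/orP; left; rewrite -us; apply/eqP/setP => z; rewrite !inE.
  by case: eqP => [->|]; rewrite ?(negPf xu).
have sx : s :\ x = s by apply/setDidPl; rewrite disjoint_sym disjoints1.
have tx : t :\ x = s by rewrite tE setU1K.
(* Here [v] is [u] or its partner. Matched pairs are disjoint or equal, so the matching restricts to
   [D] without [s] and [t]. *)
have closed v u : u \in D -> e v = e u -> v :\: e u = u :\: e u ->
    u \notin [set s; t] -> v \notin [set s; t].
  move=> uD ev vu; apply: contraNN; rewrite !inE => vst.
  have eux : e u = [set x].
    by rewrite -ev; case/orP: vst => /eqP->; rewrite // et.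
  apply: backst => //; rewrite -eux -vu eux.
  by case/orP: vst => /eqP->.
rewrite eqKD; apply: IHn.
- move: ltDn; rewrite (cardsD1 s D) sD (cardsD1 t (D :\ s)) tDs.
  by rewrite !add1n ltnS => lt1; apply: ltn_trans lt1.
- move=> u v; rewrite !inE => /and3P[nvt nvs vK] uv.
  rewrite (cK u v) // andbT; apply/andP; split.
    apply: contraNneq nvt => ut; rewrite (up v) //.
    by apply: subset_trans uv; rewrite ut subsetUl.
  by apply: contraNneq nvt => us; rewrite (up v) //; rewrite -us.
- by do 2!apply: setSD.
- by rewrite -eqKD.
- apply: (matching_restrict mD).
    by apply: subset_trans (subD1set D s); apply: subD1set.
  move=> u; rewrite !inE andbA -negb_or orbC => /andP[nu uD].
  have [dD _ ed] := matching_down mD uD; have [uD' _ eu] := matching_up mD uD.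
  rewrite dD uD' !andbT -!negb_or ![(_ == t) || _]orbC; split.
    by have := closed (u :\: e u) u uD ed; rewrite !inE setDDl setUid; apply.
  have := closed (u :|: e u) u uD eu; rewrite !inE; apply=> //.
  by rewrite setDUl setDv setU0.
Qed.

End Matching.

(** * Rank and span in a semimatroid *)

Section Spans.

Variables (T : finType) (C : semimatroid T).
Implicit Types (s t u : {set T}) (x y z : T).

Lemma set0_faces : set0 \in faces C.
Proof.
by case/set0Pn: (faces_nonvoid C) => s sC; apply: faces_complex sC (sub0set s).
Qed.

Lemma independentE s : independent C s = (s \in faces C) && (rk C s == #|s|).
Proof.
rewrite /independent /dependent; case sC: (s \in faces C) => //=.
by rewrite -leqNgt eqn_leq (rk_le_card sC).
Qed.

Lemma rk_set0 : rk C set0 = 0.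
Proof. by apply/eqP; rewrite -leqn0 -(cards0 T) rk_le_card ?set0_faces. Qed.

Definition spans s x : bool :=
  (x |: s \in faces C) && (rk C (x |: s) == rk C s).

(** For [x] outside [t], the faces [x |: s] and [t] meet in [s]. Since [x |: s] has the rank of [s],
    axiom (iv) makes [x |: t] a face, and submodularity bounds its rank by that of [t]. *)
Lemma spans_mono s t x :
  s \subset t -> t \in faces C -> spans s x -> spans t x.
Proof.
move=> st tC /andP[xsC /eqP rxs].
have [xt|xNt] := boolP (x \in t).
  by rewrite /spans setUC (setUidPl _) ?sub1set // tC eqxx.
have sC := faces_complex tC st.
have capE : (x |: s) :&: t = s.
  rewrite setIUl (setIidPl st) (_ : [set x] :&: t = set0) ?set0U //.
  by apply/eqP; rewrite setI_eq0 disjoints1.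
have cupE : (x |: s) :|: t = x |: t by rewrite -setUA (setUidPr st).
have xtC : x |: t \in faces C.
  by rewrite -cupE; apply: faces_union; rewrite // capE.
have := @rk_submod _ C (x |: s) t xsC tC; rewrite cupE capE => /(_ xtC).
have := @rk_mono _ C t (x |: t) tC xtC (subsetUr _ _).
by rewrite /spans xtC /=; lia.
Qed.

Lemma rk_setU1 s x : x |: s \in faces C -> rk C (x |: s) <= (rk C s).+1.
Proof.
move=> xsC; have sC : s \in faces C by apply: faces_complex xsC (subsetUr _ _).
have xC : [set x] \in faces C by apply: faces_complex xsC (subsetUl _ _).
have := rk_submod xC sC xsC; have := rk_le_card xC; rewrite cards1; lia.
Qed.

Lemma rk_setU1N s x : x |: s \in faces C -> ~~ spans s x ->
  rk C (x |: s) = (rk C s).+1.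
Proof.
move=> xsC; rewrite /spans xsC /= => nsp.
have sC : s \in faces C by apply: faces_complex xsC (subsetUr _ _).
have := rk_mono sC xsC (subsetUr _ _); have := rk_setU1 xsC; lia.
Qed.

(** Axiom (v) may return a [y] that does not raise the rank. Such a [y] is added to [s] and the
    search continues; what the larger face does not span, [s] does not span either. *)
Lemma exchange_rk s t : s \in faces C -> t \in faces C -> rk C s < rk C t ->
  exists y, [/\ y \in t :\: s, y |: s \in faces C & ~~ spans s y].
Proof.
have [n] := ubnP #|t :\: s|; elim: n s => // n IHn s ltn sC tC lt_st.
have [y yts ysC] := faces_exchange sC tC lt_st.
have [sp|] := boolP (spans s y); last by exists y.
have [||||z [zt zC zsp]] := IHn (y |: s) => //.
- rewrite -ltnS; apply: leq_trans ltn; rewrite ltnS (cardsD1 y (t :\: s)) yts.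
  rewrite add1n ltnS subset_leq_card //.
  by apply/subsetP => z; rewrite !inE; case: (z == y).
- by case/andP: sp => _ /eqP->.
exists z; split.
- by move: zt; rewrite !inE negb_or => /andP[/andP[_ ->]].
- by apply: faces_complex zC _; apply: setUS; apply: subsetUr.
by apply: contra zsp; apply: spans_mono => //; apply: subsetUr.
Qed.

Lemma independent_sub s t : s \subset t -> independent C t -> independent C s.
Proof.
have [n] := ubnP #|t :\: s|; elim: n t => // n IHn t ltn st it.
have [/eqP|[x]] := set_0Vmem (t :\: s).
  by rewrite setD_eq0 => ts; have /eqP-> : s == t by rewrite eqEsubset st.
move=> xts; have /setDP[xt xs] := xts; apply: (IHn (t :\ x)).
- rewrite -ltnS; apply: leq_trans ltn; rewrite ltnS (cardsD1 x (t :\: s)) xts.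
  rewrite add1n ltnS subset_leq_card //.
  by apply/subsetP => z; rewrite !inE; case: (z == x) => //=; rewrite andbF.
- by rewrite subsetD1 st.
move: it; rewrite !independentE => /andP[tC /eqP rt].
have dC : t :\ x \in faces C by apply: faces_complex tC (subD1set _ _).
rewrite dC eqn_leq rk_le_card //=.
have := @rk_setU1 (t :\ x) x; rewrite setD1K // => /(_ tC).
by rewrite rt (cardsD1 x) xt.
Qed.

Lemma independent_setU1 s x : independent C s -> x |: s \in faces C ->
  ~~ spans s x -> independent C (x |: s).
Proof.
move=> it xsC nsp; rewrite independentE xsC rk_setU1N //.
have xs : x \notin s.
  apply: contra nsp => xs; rewrite /spans xsC /= (setUidPr _) ?sub1set //.
by move: it; rewrite independentE cardsU1 xs => /andP[_ /eqP->]; rewrite add1n /= eqxx.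
Qed.

Lemma augment s t : independent C s -> t \in faces C -> #|s| <= rk C t ->
  exists u, [/\ independent C u, s \subset u, u \subset s :|: t & #|u| = rk C t].
Proof.
have [n] := ubnP (rk C t - #|s|); elim: n s => // n IHn s ltn si tC.
rewrite leq_eqVlt => /orP[/eqP eqs|lts].
  by exists s; split=> //; apply: subsetUl.
have := si; rewrite independentE => /andP[sC /eqP rs].
have [|y [/setDP[yt ys] yC nsp]] := exchange_rk sC tC; first by rewrite rs.
have yi := independent_setU1 si yC nsp.
have cy : #|y |: s| = #|s|.+1 by rewrite cardsU1 ys.
have [||||u [ui su ust cu]] := IHn (y |: s) => //; rewrite ?cy //; first lia.
exists u; split=> //; first by apply: subset_trans su; apply: subsetUr.
apply: subset_trans ust _; rewrite subUset subsetUr andbT.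
by rewrite subUset sub1set subsetUl inE yt orbT.
Qed.

Lemma independent_set0 : independent C set0.
Proof. by rewrite independentE set0_faces rk_set0 cards0. Qed.

Lemma basis_rk B t : basis C B -> t \in faces C -> rk C t <= #|B|.
Proof.
move=> /maxsetP[Bi Bmax] tC; rewrite leqNgt; apply/negP => ltB.
have [u [ui Bu _ cu]] := augment Bi tC (ltnW ltB).
by move: ltB; rewrite -cu (Bmax u) ?ltnn.
Qed.

(** All bases have the same cardinality because, by augmentation, the size of a basis bounds the
    rank of every face. *)
Lemma basis_card B u : basis C B -> basis C u = independent C u && (#|u| == #|B|).
Proof.
move=> bB; have Bi := maxsetp bB; apply/idP/andP => [bu|[ui /eqP cu]].
  have ui := maxsetp bu; split=> //; rewrite eqn_leq.
  move: (ui) (Bi); rewrite !independentE => /andP[uC /eqP<-] /andP[BC /eqP <-].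
  have := basis_rk bu BC; have := basis_rk bB uC.
  move: (ui) (Bi); rewrite !independentE => /andP[_ /eqP<-] /andP[_ /eqP <-].
  by move=> -> ->.
apply/maxsetP; split=> // v vi uv; apply/esym/eqP.
rewrite eqEcard uv cu; move: vi; rewrite independentE => /andP[vC /eqP<-].
exact: basis_rk.
Qed.

Lemma basis_exists s : independent C s -> exists2 B, basis C B & s \subset B.
Proof. by move=> /maxset_exists[B bB sB]; exists B. Qed.

(* A minimal subset [w] of [t] spanning [x] is not contained in [s]; any [y] in
   [w :\: s] is spanned by [x |: w :\ y], so it can be exchanged for [x]. *)
Lemma basis_swap B s t x : basis C B -> x \notin B -> t \subset B ->
    spans t x -> ~~ spans (s :&: t) x ->
  exists y, [/\ y \in t, y \notin s & basis C (x |: B :\ y)].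
Proof.
move=> bB xNB tB tx nsp.
have BC : B \in faces C by move: (maxsetp bB); rewrite independentE => /andP[].
have [w /minsetP[wx wmin] wt] := minset_exists (P := fun w => spans w x) tx.
have wB := subset_trans wt tB.
have /subsetPn[y yw ys] : ~~ (w \subset s).
  apply: contra nsp => ws; apply: spans_mono wx; first by rewrite subsetI ws.
  by apply: faces_complex BC _; apply: subset_trans tB; apply: subsetIr.
exists y; split=> //; first exact: (subsetP wt).
have yB := subsetP wB y yw.
have /andP[xBC /eqP rxB] := spans_mono wB BC wx.
have sub1 : x |: B :\ y \subset x |: B by rewrite setUS ?subD1set.
have xyC := faces_complex xBC sub1.
have cE : #|x |: B :\ y| = #|B|.
  by rewrite cardsU1 !inE (negPf xNB) andbF (cardsD1 y B) yB.
have sy : spans (x |: B :\ y) y.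
  have sub2 : x |: w :\ y \subset x |: B :\ y by rewrite setUS ?setSD.
  apply: (spans_mono sub2) => //.
  have xw2C := faces_complex xyC sub2.
  have nspw : ~~ spans (w :\ y) x.
    apply: contraL yw => /wmin; rewrite subD1set => /(_ isT) <-.
    by rewrite !inE eqxx.
  have yxw : y |: (x |: w :\ y) = x |: w by rewrite setUCA setD1K.
  have /andP[xwC /eqP rxw] := wx.
  have wyC : w :\ y \in faces C by apply: faces_complex xw2C (subsetUr _ _).
  have wC : w \in faces C by apply: faces_complex xwC (subsetUr _ _).
  have sub3 : x |: w :\ y \subset x |: w by rewrite setUS ?subD1set.
  (* Minimality of [w] makes [x] raise the rank of [w :\ y], so [x |: w :\ y] already has rank at
     least [rk C w], the rank of [x |: w]. *)
  rewrite /spans yxw xwC /= eqn_leq (rk_mono xw2C xwC sub3) andbT rxw.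
  rewrite (rk_setU1N xw2C nspw) -{1}(setD1K yw).
  by apply: rk_setU1; rewrite setD1K.
rewrite (basis_card _ bB) cE eqxx andbT independentE xyC cE.
move: sy => /andP[_]; rewrite setUCA setD1K // rxB => /eqP <-.
by move: (maxsetp bB); rewrite independentE => /andP[].
Qed.

End Spans.

(** * Matchings of the faces and of the no-broken circuits *)

Section Ordered.

Variables (d : Order.disp_t) (S : finOrderType d).
Implicit Types (s t u B : {set S}) (x y m : S).

Definition minima s : {set S} := [set x in s | [forall y in s, (x <= y)%O]].

Lemma minima1 s : s != set0 ->
  exists x, [/\ minima s = [set x], x \in s & {in s, forall y, (x <= y)%O}].
Proof.
case/set0Pn => x0 x0s; case: (arg_minP id x0s) => x xs xmin.
exists x; split=> //; apply/setP => y; rewrite !inE; apply/andP/eqP => [[ys]|->].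
  by move=> /forall_inP/(_ x xs) yx; apply: le_anti; rewrite yx xmin.
by split=> //; apply/forall_inP.
Qed.

Definition above s m : {set S} := [set y in s | (m < y)%O].

Lemma above_sub s m : above s m \subset s.
Proof. by apply/subsetP => y; rewrite inE => /andP[]. Qed.

Lemma aboveS s t m : s \subset t -> above s m \subset above t m.
Proof.
by move=> /subsetP st; apply/subsetP => y; rewrite !inE => /andP[/st-> ->].
Qed.

(** * Elements spanned by larger ones, and no-broken circuits *)

Variable C : semimatroid S.

(** The up-set generated by the elements [m] spanned by the larger elements of [s]. An up-set of a
    linear order is determined by its least element, here the element to toggle, and its cardinality
    can serve as a potential. *)
Definition shadow s : {set S} :=
  [set y | [exists m, (m <= y)%O && spans C (above s m) m]].

Lemma shadowP s y :
  reflect (exists2 m, (m <= y)%O & spans C (above s m) m) (y \in shadow s).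
Proof. by rewrite inE; apply: exists_inP. Qed.

Lemma shadowS s t : s \subset t -> t \in faces C -> shadow s \subset shadow t.
Proof.
move=> st tC; apply/subsetP => y /shadowP[m my sp]; apply/shadowP; exists m => //.
apply: spans_mono sp; first exact: aboveS.
exact: faces_complex tC (above_sub _ _).
Qed.

Lemma mem_minima_shadow s m : m \in shadow s ->
  {in shadow s, forall y, (m <= y)%O} -> spans C (above s m) m.
Proof.
case/shadowP => m' m'm sp min; suff -> : m = m' by [].
by apply: le_anti; rewrite m'm min //; apply/shadowP; exists m'.
Qed.

Lemma dependent_circuit s : dependent C s ->
  exists c m, [/\ circuit C c, c \subset s, m \in c & {in c, forall y, (m <= y)%O}].
Proof.
move=> /minset_exists[c cc cs]; exists c.
have : c != set0.
  apply/eqP => c0; move: (minsetp cc); rewrite c0 => /andP[_].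
  by rewrite rk_set0 cards0.
by case/minima1 => m [_ mc min]; exists m.
Qed.

(** By minimality [c :\ m] is independent, so its rank [#|c| - 1] is at least [rk C c]. Hence it
    spans [m], and all its elements exceed [m]. *)
Lemma circuit_shadow s c m : s \in faces C -> circuit C c -> m \in c ->
  {in c, forall y, (m <= y)%O} -> c :\ m \subset s -> m \in shadow s.
Proof.
move=> sC /minsetP[/andP[cC rc] cmin] mc min cms.
apply/shadowP; exists m => //.
have sub : c :\ m \subset above s m.
  apply/subsetP => y yc; rewrite inE (subsetP cms) //=.
  by move: yc; rewrite !inE lt_neqAle eq_sym => /andP[-> /min->].
apply: spans_mono sub _ _; first exact: faces_complex sC (above_sub _ _).
have dC : c :\ m \in faces C by apply: faces_complex cC (subD1set _ _).
have : ~~ dependent C (c :\ m).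
  apply: contraL mc => /cmin; rewrite subD1set => /(_ isT) <-.
  by rewrite !inE eqxx.
rewrite /dependent dC /= -leqNgt => rd.
rewrite /spans setD1K // cC eqn_leq (rk_mono dC cC) ?subD1set // andbT.
by rewrite -ltnS; apply: leq_trans rc _; rewrite (cardsD1 m) mc add1n ltnS.
Qed.

Lemma mem_BC s : (s \in BC C) = (s \in faces C) && (shadow s == set0).
Proof.
rewrite inE; case sC: (s \in faces C) => //=.
apply/forallP/eqP => [nb|sh0 t].
  apply/eqP; apply: contraT => /set0Pn[_ /shadowP[m _ sp]].
  have dm : dependent C (m |: above s m).
    have mNa : m \notin above s m by rewrite inE ltxx andbF.
    case/andP: sp => maC /eqP rma; rewrite /dependent maC rma cardsU1 mNa add1n.
    rewrite ltnS; apply: rk_le_card; exact: faces_complex maC (subsetUr _ _).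
  have [c [x [cc cs xc xmin]]] := dependent_circuit dm.
  have /implyP/(_ _)/negP[] := nb (c :\ x).
    apply/existsP; exists c; apply/existsP; exists x; rewrite xc cc eqxx andbT.
    exact/forall_inP.
  (* The element [m] is below all of [above s m], so it can lie in [c] only as the minimum [x]; the
     rest of [c] lies in [s]. *)
  apply/subsetP => y /setD1P[yx yc].
  have := subsetP cs _ yc; rewrite !inE => /orP[/eqP ym|/andP[] //].
  have := subsetP cs _ xc; rewrite !inE => /orP[/eqP xm|/andP[_ mx]].
    by rewrite ym xm eqxx in yx.
  by have := xmin _ yc; rewrite ym leNgt mx.
apply/implyP => /existsP[c /existsP[m /and4P[mc cc /forall_inP min /eqP->]]].
apply/negP => cms; have := circuit_shadow sC cc mc min cms.
by rewrite sh0 inE.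
Qed.

Lemma BC_faces s : s \in BC C -> s \in faces C.
Proof. by rewrite mem_BC => /andP[]. Qed.

Lemma BC_complex : simplicial_complex (BC C).
Proof.
move=> s t; rewrite !mem_BC => /andP[tC /eqP sh0] st.
by rewrite (faces_complex tC st) -subset0 -sh0 shadowS.
Qed.

Lemma BC_spans s m : s \in BC C -> ~~ spans C (above s m) m.
Proof.
rewrite mem_BC => /andP[_ /eqP sh0]; apply/negP => sp.
by have : m \in shadow s; [apply/shadowP; exists m | rewrite sh0 inE].
Qed.

Lemma BC_independent s : s \in BC C -> independent C s.
Proof.
rewrite /independent mem_BC => /andP[sC sh0]; rewrite sC /=; apply: contraTN sh0.
case/dependent_circuit => c [m [cc cs mc min]]; apply/set0Pn; exists m.
apply: circuit_shadow cc mc min _ => //.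
exact: subset_trans (subD1set _ _) cs.
Qed.

Lemma spans_trans s x y : spans C s x -> spans C (x |: s) y -> spans C s y.
Proof.
move=> /andP[xC /eqP rx] /andP[yxC /eqP ryx].
have sub : y |: s \subset y |: (x |: s) by rewrite setUS ?subsetUr.
have yC := faces_complex yxC sub.
have sC := faces_complex yC (subsetUr _ _).
rewrite /spans yC eqn_leq (rk_mono sC yC) ?subsetUr // andbT /=.
by rewrite -rx -ryx rk_mono.
Qed.

(* Toggling the least element [m] spanned by the larger elements of a face keeps
   its span, hence its rank and the set of elements spanned in this way. *)
Lemma broken_matching : exists e phi,
  [/\ acyclic_matching (faces C :\: BC C) e phi,
      {in faces C :\: BC C, forall s, rk C (s :\: e s) = rk C s}
    & {in faces C :\: BC C, forall s, rk C (s :|: e s) = rk C s}].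
Proof.
have memD s : (s \in faces C :\: BC C) = (s \in faces C) && (shadow s != set0).
  by rewrite inE mem_BC; case: (s \in faces C); rewrite ?andbT ?andbF.
have toggle s : s \in faces C :\: BC C -> exists m,
    [/\ minima (shadow s) = [set m], spans C (above s m) m,
        s :\ m \in faces C, m |: s \in faces C & spans C (s :\ m) m].
  rewrite memD => /andP[sC /minima1[m [mE ms min]]]; exists m.
  have sp := mem_minima_shadow ms min.
  have dC : s :\ m \in faces C by apply: faces_complex sC (subD1set _ _).
  have sp1 : spans C (s :\ m) m.
    apply: spans_mono sp => //; apply/subsetP => y; rewrite !inE.
    by case/andP=> ->; rewrite lt_neqAle eq_sym => /andP[->].
  split=> //; have /andP[] : spans C s m.
    by apply: spans_mono sp => //; apply: above_sub.
  by [].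
have rkE s m : spans C (s :\ m) m -> rk C (m |: s) = rk C (s :\ m).
  move=> /andP[_ /eqP <-]; congr (rk C _); apply/setP => y; rewrite !inE.
  by case: eqP.
(* Shadows grow with the face, so nested faces with shadows of equal size have equal shadows and
   toggle the same element. *)
exists (fun s => minima (shadow s)), (fun s => #|shadow s|); split.
- split=> [s sD|s t].
    have [m [mE sp dC uC sp1]] := toggle s sD.
    have sC : s \in faces C by move: sD; rewrite memD => /andP[].
    rewrite mE cards1 ![s :|: _]setUC !memD dC uC /=.
    have md : m \in shadow (s :\ m).
      apply/shadowP; exists m => //; apply: spans_mono sp.
        apply/subsetP => y; rewrite !inE => /andP[->] /=.
        by rewrite lt_neqAle eq_sym => /andP[->].
      exact: faces_complex dC (above_sub _ _).
    have sub : shadow (s :\ m) \subset shadow (m |: s).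
      by apply: shadowS => //; apply: subset_trans (subD1set _ _) (subsetUr _ _).
    split=> //; try by apply/set0Pn; exists m; rewrite ?(subsetP sub).
    apply/eqP; rewrite eqn_leq subset_leq_card //=; apply: subset_leq_card.
    apply/subsetP => y /shadowP[x xy spx]; apply/shadowP; exists x => //.
    have [mx|xm] := leP m x.
      rewrite (_ : above _ x = above (m |: s) x) //; apply/setP => z.
      rewrite !inE; case: eqP => [->|] //=.
      by rewrite ltNge mx.
    have aE : above (m |: s) x = m |: above (s :\ m) x.
      apply/setP => z; rewrite !inE; case: eqP => [->|] //=; by rewrite xm.
    rewrite aE in spx; apply: spans_trans spx; apply: spans_mono sp.
      apply/subsetP => z; rewrite !inE => /andP[->] mz.
      by rewrite (lt_trans xm mz) gt_eqF.
    exact: faces_complex dC (above_sub _ _).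
  rewrite !memD => _ /andP[tC _] st; have sub := shadowS st tC.
  split=> [|eqc]; first exact: subset_leq_card.
  by congr minima; apply/eqP; rewrite eqEcard sub eqc leqnn.
- move=> s sD; have [m [-> sp dC uC sp1]] := toggle s sD.
  have sC : s \in faces C by move: sD; rewrite memD => /andP[].
  apply/eqP; rewrite eqn_leq (rk_mono dC sC) ?subD1set //=.
  by rewrite -rkE // rk_mono ?subsetUr.
- move=> s sD; have [m [-> sp dC uC sp1]] := toggle s sD.
  have sC : s \in faces C by move: sD; rewrite memD => /andP[].
  apply/eqP; rewrite setUC eqn_leq andbC (rk_mono sC uC) ?subsetUr //=.
  by rewrite rkE // rk_mono ?subD1set.
Qed.

(* The exchanges range over all bases, whereas [critical] asks for members of
   [BC C]; by [CBC_optimal] this makes no difference. *)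
Definition passive B : {set S} :=
  [set x in B | [exists y, [&& (y < x)%O, y \notin B & basis C (y |: B :\ x)]]].

Definition weight B : nat := \sum_(x in B) #|[set z | (z < x)%O]|.

Lemma weightU1 B x : x \notin B ->
  weight (x |: B) = #|[set z | (z < x)%O]| + weight B.
Proof. by move=> xB; rewrite /weight big_setU1. Qed.

Lemma card_below x y :
  (#|[set z | (z < x)%O]| < #|[set z | (z < y)%O]|) = (x < y)%O.
Proof.
have lt a b : (a < b)%O -> (#|[set z | (z < a)%O]| < #|[set z | (z < b)%O]|).
  move=> ab; apply: proper_card; apply/properP; split.
    by apply/subsetP => z; rewrite !inE => /lt_trans; apply.
  by exists a; rewrite !inE ?ltxx.
have [/lt//|/lt gt|->] := ltgtP x y; last by rewrite ltnn.
by rewrite ltnNge ltnW.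
Qed.

Lemma weight_swap B x y : x \in B -> y \notin B ->
  (weight (y |: B :\ x) < weight B) = (y < x)%O.
Proof.
move=> xB yB; rewrite -{2}(setD1K xB) !weightU1 ?inE ?eqxx //.
  by rewrite ltn_add2r card_below.
by rewrite negb_and yB orbT.
Qed.

(* The intervals between [passive B] and [B], for [B] a basis in [BC C],
   partition [BC C]: this is its lexicographic shelling. *)
Definition optimal s B := [&& basis C B, passive B \subset s & s \subset B].

(** A passive element of [B] outside [s] could be exchanged for a smaller one, giving a lighter
    basis that still contains [s]. *)
Lemma optimal_min s B : basis C B -> s \subset B ->
  (forall B', basis C B' -> s \subset B' -> weight B <= weight B') ->
  optimal s B.
Proof.
move=> bB sB min; rewrite /optimal bB sB andbT /=; apply/subsetP => x.
rewrite inE => /andP[xB /existsP[y /and3P[yx yB bB']]].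
apply: contraT => xs; have /min : s \subset y |: B :\ x.
  by apply: subset_trans (subsetUr _ _); rewrite subsetD1 sB.
by rewrite leqNgt weight_swap // yx => /(_ bB').
Qed.

Lemma optimal_exists s : independent C s -> exists2 B, optimal s B &
  forall B', basis C B' -> s \subset B' -> weight B <= weight B'.
Proof.
case/basis_exists => B0 bB0 sB0.
have P0 : basis C B0 && (s \subset B0) by rewrite bB0.
case: (@arg_minnP _ B0 (fun B => basis C B && (s \subset B)) weight P0) => B.
case/andP=> bB sB min.
have min' B' : basis C B' -> s \subset B' -> weight B <= weight B'.
  by move=> bB' sB'; apply: min; rewrite bB'.
by exists B => //; apply: optimal_min.
Qed.

(** Augmenting [a |: B :&: B'] from [B] gives a basis [a |: B :\ x] with [x] in [B :\: B'], and
    [a < x] by hypothesis. *)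
Lemma passive_exchange B B' a : basis C B -> basis C B' -> a \in B' :\: B ->
    {in B :\: B', forall x, (a < x)%O} ->
  exists x, (x \in passive B) && (x \notin B').
Proof.
move=> bB bB' /setDP[aB' aB] amin.
have Xi : independent C (a |: B :&: B').
  apply: independent_sub (maxsetp bB'); by rewrite subUset sub1set aB' subsetIr.
have : independent C B := maxsetp bB; rewrite independentE => /andP[BC /eqP rB].
have cX : #|a |: B :&: B'| <= rk C B.
  have : independent C B' := maxsetp bB'; rewrite rB.
  rewrite (basis_card B' bB) in bB'; case/andP: bB' => _ /eqP <- _.
  by apply: subset_leq_card; rewrite subUset sub1set aB' subsetIr.
have [u [ui Xu uX cu]] := augment Xi BC cX; rewrite rB in cu.
have au : a \in u by apply: (subsetP Xu); rewrite setU11.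
have /subsetPn[x xB xu] : ~~ (B \subset u).
  apply/negP => Bu; have : B == u by rewrite eqEcard Bu cu leqnn.
  by move=> /eqP E; rewrite E au in aB.
have xB' : x \notin B'.
  by apply: contra xu => xB'; apply: (subsetP Xu); rewrite !inE xB xB' orbT.
have uE : u = a |: B :\ x.
  apply/eqP; rewrite eqEcard cardsU1 !inE (negPf aB) andbF cu (cardsD1 x B) xB.
  rewrite leqnn andbT; apply/subsetP => z zu; have := subsetP uX _ zu; rewrite !inE.
  have -> : (z == x) = false by apply: contraNF xu => /eqP <-.
  by case: (z == a) => //=; case: (z \in B).
exists x; rewrite xB' andbT inE xB; apply/existsP; exists a.
by rewrite aB amin ?inE ?xB ?xB' //= -uE (basis_card _ bB) ui cu eqxx.
Qed.

(** If [a], the least element of the symmetric difference, lies in [B'], then [B] has a passive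
    element outside [B']. This contradicts the inclusions of [passive B] in [s] and of [s] in
    [B']. *)
Lemma optimal_uniq s B B' : optimal s B -> optimal s B' -> B = B'.
Proof.
move=> oB oB'; apply/eqP; apply: contraT => nBB'.
have : (B :\: B') :|: (B' :\: B) != set0.
  apply: contraNneq nBB' => E; rewrite eqEsubset -!setD_eq0 -!subset0 -E.
  by rewrite subsetUl subsetUr.
case/minima1 => a [_ aBB' amin].
wlog aB' : B B' oB oB' nBB' aBB' amin / a \in B' :\: B.
  move=> W; have := aBB'; rewrite inE => /orP[aB|aB'].
    by apply: (W B' B); rewrite 1?setUC // 1?eq_sym // setUC.
  exact: (W B B').
case/and3P: oB => bB pB sB; case/and3P: oB' => bB' pB' sB'.
have [|x /andP[xp /negP[]]] := @passive_exchange B B' a bB bB' aB'.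
  move=> x xB; rewrite lt_neqAle amin ?inE; last by move: xB; rewrite inE => ->.
  rewrite andbT; apply: contraTneq xB => <-; move: aB'; rewrite !inE.
  by case/andP=> /negPf->; rewrite andbF.
by apply: (subsetP sB'); apply: (subsetP pB).
Qed.

(** Suppose [above B m] spans [m]. As [above s m] does not, [basis_swap] exchanges for [m] some
    larger [x] of [B] outside [s]. Then [x] is passive but not in [s]. *)
Lemma optimal_BC s B : s \in BC C -> optimal s B -> B \in BC C.
Proof.
move=> sBC /and3P[bB pB sB]; have Bi : independent C B := maxsetp bB.
rewrite mem_BC; have := Bi; rewrite independentE => /andP[-> _] /=.
apply: contraT => /set0Pn[_ /shadowP[m _ sp]].
have mB : m \notin B.
  apply/negP => mB; have mNa : m \notin above B m by rewrite inE ltxx andbF.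
  have : independent C (m |: above B m).
    by apply: independent_sub Bi; rewrite subUset sub1set mB above_sub.
  have : independent C (above B m) by apply: independent_sub Bi; apply: above_sub.
  rewrite !independentE => /andP[_ /eqP r1] /andP[_].
  by case/andP: sp => _ /eqP->; rewrite r1 cardsU1 mNa; lia.
have [|x [xa xs bx]] := basis_swap bB mB (above_sub B m) sp (s := s).
  rewrite (_ : s :&: _ = above s m) ?BC_spans //; apply/setP => z; rewrite !inE.
  by case: (boolP (z \in s)) => //= /(subsetP sB) ->.
move: xa; rewrite inE => /andP[xB mx]; case/negP: xs; apply: (subsetP pB).
by rewrite inE xB; apply/existsP; exists m; rewrite mx mB.
Qed.

Definition optimal_basis s : {set S} := odflt set0 [pick B | optimal s B].

Lemma optimal_basisP s : s \in BC C -> optimal s (optimal_basis s).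
Proof.
move=> /BC_independent/optimal_exists[B oB _]; rewrite /optimal_basis.
by case: pickP => // /(_ B); rewrite oB.
Qed.

Lemma optimal_basis_min s B : s \in BC C -> basis C B -> s \subset B ->
  weight (optimal_basis s) <= weight B.
Proof.
move=> sBC; have [B' oB' min] := optimal_exists (BC_independent sBC).
by rewrite (optimal_uniq (optimal_basisP sBC) oB'); apply: min.
Qed.

(** Either side forces [s = B]. Exchanges within [BC C] yield bases, by cardinality. Conversely, if
    [x] is passive, the lightest basis containing [B :\ x] lies in [BC C] and is lighter than [B],
    so it is [z |: B :\ x] with [z < x]. *)
Lemma CBC_optimal s B : s \in BC C -> optimal s B ->
  (s \in CBC C) = (B \subset passive B).
Proof.
move=> sBC oB; rewrite inE sBC /=; case/and3P: (oB) => bB pB sB.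
apply/andP/idP => [[/forall_inP cr bs]|Bp].
  have sE : s = B.
    apply/eqP; rewrite eqEcard sB.
    by move: bs; rewrite (basis_card _ bB) => /andP[_ /eqP->] /=.
  rewrite -sE; apply/subsetP => x xs; rewrite inE xs.
  have /existsP[y /and3P[yx ys /BC_independent yi]] := cr x xs.
  apply/existsP; exists y; rewrite yx ys (basis_card _ bs) yi /=.
  by rewrite cardsU1 !inE (negPf ys) andbF (cardsD1 x s) xs.
have sE : s = B by apply/eqP; rewrite eqEsubset sB (subset_trans Bp pB).
rewrite sE; split=> //; apply/forall_inP => x xB.
have := subsetP Bp x xB; rewrite inE xB => /existsP[y /and3P[yx yB bByx]].
have tBC : B :\ x \in BC C.
  by rewrite -sE; apply: BC_complex sBC (subD1set _ _).
have oB' := optimal_basisP tBC; have B'BC := optimal_BC tBC oB'.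
have := optimal_basis_min tBC bByx (subsetUr _ _).
case/and3P: oB' => bB' _; set B' := optimal_basis _ in bB' B'BC * => tB' w.
have cB' : #|B'| = #|B :\ x|.+1.
  by move: bB'; rewrite (basis_card _ bB) => /andP[_ /eqP->]; rewrite (cardsD1 x) xB.
have /subsetPn[z zB' zt] : ~~ (B' \subset B :\ x).
  by apply/negP => /subset_leq_card; rewrite cB' ltnn.
have B'E : B' = z |: B :\ x.
  apply/esym/eqP; rewrite eqEcard cardsU1 zt cB' leqnn andbT.
  by rewrite subUset sub1set zB'.
have lt : weight B' < weight B by apply: leq_ltn_trans w _; rewrite weight_swap.
have zx : z != x.
  by apply: contraTneq lt => zx; rewrite B'E zx setD1K // ltnn.
have zB : z \notin B by move: zt; rewrite !inE zx.
by apply/existsP; exists z; rewrite -B'E B'BC zB -(weight_swap xB zB) -B'E lt.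
Qed.

Lemma shelling_matching :
  exists e phi, acyclic_matching (BC C :\: CBC C) e phi.
Proof.
(* Toggling an element of [A s] stays between [passive B] and [B], so the optimal basis [B] is
   unchanged. [A s] is empty exactly when [s] is in [CBC C]. *)
pose A s := optimal_basis s :\: passive (optimal_basis s).
exists (fun s => minima (A s)), (fun s => weight (optimal_basis s)); split=> [s|s t].
  rewrite inE => /andP[sCBC sBC]; have oB := optimal_basisP sBC.
  rewrite (CBC_optimal sBC oB) in sCBC.
  have [|x [-> xA _]] := @minima1 (A s); first by rewrite setD_eq0.
  case/setDP: xA => xB xp; case/and3P: (oB) => bB pB sB.
  have BBC := optimal_BC sBC oB.
  have od : optimal (s :\ x) (optimal_basis s).
    by rewrite /optimal bB subsetD1 pB xp (subset_trans (subD1set _ _) sB).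
  have ou : optimal (x |: s) (optimal_basis s).
    by rewrite /optimal bB (subset_trans pB (subsetUr _ _)) subUset sub1set xB.
  have dBC : s :\ x \in BC C by apply: BC_complex sBC (subD1set _ _).
  have uBC : x |: s \in BC C by apply: BC_complex BBC _; case/and3P: ou.
  rewrite setUC cards1 !in_setD (CBC_optimal dBC od) (CBC_optimal uBC ou).
  rewrite sCBC dBC uBC.
  rewrite (optimal_uniq (optimal_basisP dBC) od).
  by rewrite (optimal_uniq (optimal_basisP uBC) ou).
rewrite !in_setD => /andP[_ sBC] /andP[_ tBC] st.
case/and3P: (optimal_basisP tBC) => bt _ tB; have sB := subset_trans st tB.
split=> [|wE]; first exact: optimal_basis_min.
(* With equal weights, the optimal basis of [t] is also a lightest basis containing [s], so
   uniqueness applies. *)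
suff oB : optimal s (optimal_basis t).
  by rewrite /A (optimal_uniq (optimal_basisP sBC) oB).
by apply: optimal_min => // B' bB' sB'; rewrite -wE optimal_basis_min.
Qed.

End Ordered.

Local Open Scope ring_scope.

(** * Homology of a complex with an acyclic matching *)

Section Chains.

Variables (F : fieldType) (d : Order.disp_t) (S : finOrderType d).
Implicit Types (K L A : {set {set S}}) (s t : {set S}) (c : chain F S).

Definition simplex_span A : {vspace chain F S} :=
  <<[seq simplex_chain F s | s in A]>>%VS.

Lemma simplex_spanP A c :
  reflect (forall s, c s != 0 -> s \in A) (c \in simplex_span A).
Proof.
apply: (iffP idP) => [cA s|cA].
  apply: contraNT => sA; rewrite (coord_span (X := image_tuple _ A) cA).
  rewrite sum_ffunE big1 // => i _; rewrite ffunE nth_image ffunE.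
  case: eqP => [sE|_]; last exact: mulr0.
  by rewrite sE enum_valP in sA.
have -> : c = \sum_(s in A) (c s : F) *: simplex_chain F s.
  apply/ffunP => t; rewrite sum_ffunE.
  have [tA|tA] := boolP (t \in A).
    rewrite (bigD1 t) //= big1 ?addr0 => [|s /andP[_ st]]; rewrite !ffunE.
      by rewrite eqxx [RHS]mulr1.
    by rewrite eq_sym (negPf st) [LHS]mulr0.
  rewrite big1 => [|s sA]; last first.
    rewrite !ffunE; case: eqP => [ts|_]; last exact: mulr0.
    by rewrite ts sA in tA.
  by apply/eqP; apply: contraNT tA => /cA.
by apply: rpred_sum => s sA; apply: rpredZ; apply: memv_span; apply: image_f.
Qed.

Lemma dim_simplex_span A : \dim (simplex_span A) = #|A|.
Proof.
suff : free [seq simplex_chain F s | s in A] by move/eqP->; rewrite size_image.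
apply/(@freeP _ _ _ (image_tuple _ A)) => k k0 i.
have := congr1 (fun c : chain F S => c (enum_val i)) k0.
rewrite sum_ffunE ffunE (bigD1 i) //= big1 ?addr0 => [|j ji].
  by rewrite ffunE nth_image ffunE eqxx [_ *: _]mulr1.
rewrite ffunE nth_image ffunE eq_sym (inj_eq enum_val_inj) (negPf ji).
exact: mulr0.
Qed.

Lemma boundaryE c s :
  boundary F S c s = \sum_(t : {set S}) c t * simplex_boundary F t s.
Proof.
rewrite /boundary lfunE /= /boundary_fun sum_ffunE.
by apply: eq_bigr => t _; rewrite ffunE.
Qed.

Lemma simplex_boundaryE t s : simplex_boundary F t s =
  \sum_(x in t | s == t :\ x) (-1) ^+ #|[set y in t | (y < x)%O]|.
Proof.
rewrite /simplex_boundary sum_ffunE big_mkcondr; apply: eq_bigr => x _.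
rewrite !ffunE; case: eqP => _; [exact: mulr1|exact: mulr0].
Qed.

Lemma simplex_boundary_face t x : x \in t ->
  simplex_boundary F t (t :\ x) = (-1) ^+ #|[set y in t | (y < x)%O]|.
Proof.
move=> xt; rewrite simplex_boundaryE (bigD1 x) ?xt ?eqxx //= big1 ?addr0 //.
move=> y /andP[/andP[yt /eqP E]] yx; have : y \in t :\ x by rewrite !inE yx.
by rewrite E !inE eqxx.
Qed.

Lemma simplex_boundary_neq0 t s : simplex_boundary F t s != 0 ->
  exists2 x, x \in t & s = t :\ x.
Proof.
rewrite simplex_boundaryE.
case: (pickP (fun x => (x \in t) && (s == t :\ x))) => [x /andP[xt /eqP->] _|none].
  by exists x.
by rewrite big_pred0 ?eqxx.
Qed.

Lemma boundary_simplex s : boundary F S (simplex_chain F s) = simplex_boundary F s.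
Proof.
apply/ffunP => t; rewrite boundaryE (bigD1 s) //= big1 ?addr0 => [|u us].
  by rewrite ffunE eqxx mul1r.
by rewrite ffunE (negPf us) mul0r.
Qed.

(** The two orders of deleting [x] and [y] have opposite signs: deleting the smaller one first
    lowers the position of the larger by one, while the other order shifts nothing. *)
Lemma boundary_simplex_boundary s : boundary F S (simplex_boundary F s) = 0.
Proof.
pose n (x : S) : nat := #|[set y in s | (y < x)%O]|.
pose n' (x y : S) : nat := #|[set z in s :\ x | (z < y)%O]|.
pose f (x y : S) : chain F S := (-1) ^+ (n x + n' x y) *: simplex_chain F (s :\ x :\ y).
have lt_n x y : (x < y)%O -> x \in s -> n y = (n' x y).+1.
  move=> xy xs; rewrite /n /n' (cardsD1 x) inE xs xy add1n; congr _.+1.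
  by apply: eq_card => z; rewrite !inE andbA.
have gt_n x y : (x < y)%O -> n' y x = n x.
  move=> xy; apply: eq_card => z; rewrite !inE.
  by case: eqP => [->|//]; rewrite (ltNge y) (ltW xy) !andbF /=.
have anti x y : (x < y)%O -> x \in s -> f y x = - f x y.
  move=> xy xs; rewrite /f (lt_n _ _ xy xs) (gt_n _ _ xy) !setDDl [[set y] :|: _]setUC.
  by rewrite addSn exprS mulN1r scaleNr addnC.
have -> : boundary F S (simplex_boundary F s) =
    \sum_(x in s) \sum_(y in s | y != x) f x y.
  rewrite /simplex_boundary linear_sum; apply: eq_bigr => x xs.
  rewrite linearZ /= boundary_simplex /simplex_boundary scaler_sumr.
  apply: eq_big => [y|y _]; first by rewrite !inE andbC.
  by rewrite scalerA -exprD.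
transitivity (\sum_(x in s) \sum_(y in s | (y < x)%O) f x y
            + \sum_(x in s) \sum_(y in s | (x < y)%O) f x y).
  rewrite -big_split; apply: eq_bigr => x xs /=.
  rewrite (bigID (fun y => (y < x)%O)) /=; congr (_ + _); apply: eq_bigl => y.
    by case: (y \in s) => //=; rewrite lt_neqAle andbA andbb.
  by case: (y \in s) => //=; rewrite -leNgt lt_neqAle eq_sym.
rewrite (exchange_big_dep (mem s)) /=; last by move=> x y _ /andP[].
rewrite -big_split big1 // => x xs /=.
apply/eqP; rewrite addr_eq0 -sumrN; apply/eqP; apply: eq_big => [y|y].
  by rewrite xs.
by case/and3P=> ys _ xy; apply: anti.
Qed.

Lemma boundaryK c : boundary F S (boundary F S c) = 0.
Proof.
have -> : boundary F S c = \sum_(s : {set S}) (c s : F) *: simplex_boundary F s.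
  by rewrite /boundary lfunE.
rewrite linear_sum big1 // => s _; by rewrite linearZ /= boundary_simplex_boundary scaler0.
Qed.

Lemma boundary_chains K k c : simplicial_complex K ->
  c \in chains F K k.+1 -> boundary F S c \in chains F K k.
Proof.
move=> cK /simplex_spanP cP; apply/simplex_spanP => s nz.
have /exists_inP[t _ /andP[ct]] :
    [exists t in {set S}, (c t != 0) && (simplex_boundary F t s != 0)].
  apply: contraR nz => /exists_inPn nx; rewrite boundaryE big1 // => t _.
  have := nx t isT; rewrite negb_and !negbK.
  by case/orP=> /eqP->; rewrite ?mul0r ?mulr0.
case/simplex_boundary_neq0 => x xt ->; have := cP t ct.
rewrite !inE => /andP[tK /eqP ck]; rewrite (cK _ t) ?subD1set //=.
by move: ck; rewrite (cardsD1 x) xt add1n => -[->].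
Qed.

Lemma boundary_chains0 K c : c \in chains F K 0 -> boundary F S c = 0.
Proof.
move=> /simplex_spanP cP; apply/ffunP => s; rewrite boundaryE ffunE big1 // => t _.
have [->|ct] := eqVneq (c t) 0; first exact: mul0r.
have := cP t ct; rewrite inE cards_eq0 => /andP[_ /eqP->].
by rewrite simplex_boundaryE big1 ?mulr0 // => x; rewrite inE.
Qed.

Lemma chainsS K L k : L \subset K -> (chains F L k <= chains F K k)%VS.
Proof.
move=> /subsetP sub; apply/subvP => c /simplex_spanP cP; apply/simplex_spanP => s /cP.
by rewrite !inE => /andP[/sub->].
Qed.

End Chains.

(** Restricted to the preimage of [M] in [V], [f] has the same kernel as on [V], and image
    [f @: V :&: M]; rank-nullity is applied to both restrictions. For boundaries, this links
    relative cycles to relative boundaries one degree lower. *)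
Lemma dim_relative (F : fieldType) (aT rT : vectType F) (f : 'Hom(aT, rT))
    (V : {vspace aT}) (M : {vspace rT}) :
  (\dim (f @: V + M) + \dim (V :&: f @^-1: M) = \dim V + \dim M)%N.
Proof.
have := dimv_sum_cap (f @: V) M.
have := limg_ker_dim f V; have := limg_ker_dim f (V :&: f @^-1: M).
have -> : (V :&: f @^-1: M :&: lker f = V :&: lker f)%VS.
  rewrite -capvA; congr (_ :&: _)%VS; apply/capv_idPr/subvP => v.
  by rewrite memv_ker -memv_preim => /eqP->; apply: mem0v.
have -> : (f @: (V :&: f @^-1: M) = f @: V :&: M)%VS.
  apply/eqP; rewrite eqEsubv subv_cap limgS ?capvSl //=; apply/andP; split.
    by apply/subvP => _ /memv_imgP[v /memv_capP[_ vM] ->]; rewrite memv_preim.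
  apply/subvP => w /memv_capP[/memv_imgP[v vV ->]] vM; apply: memv_img.
  by rewrite memv_cap vV -memv_preim.
lia.
Qed.

(* The hypotheses bound [z k - b k] by [c k], so all the inequalities are tight
   where [c] vanishes, hence also around [k0]. *)
Lemma tight_morse_inequalities (z b p q m c : nat -> nat) k0 :
    (forall k, z k + m k <= p k)%N -> (forall k, b k <= z k)%N ->
    (forall k, b k + z k.+1 = p k.+1 + q k)%N -> z 0%N = p 0%N ->
    (forall k, p k = q k + m k + m k.+1 + c k)%N ->
    (forall k, k != k0 -> c k = 0%N) ->
  forall k, (z k - b k = c k)%N.
Proof.
move=> zm bz bzE z0 pE ck k.
have [kk0|/ck ck0] := eqVneq k k0; last first.
  by move: (zm k) (zm k.+1) (bzE k) (pE k); rewrite ck0; lia.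
have ck1 : c k.+1 = 0%N by apply: ck; rewrite -kk0; lia.
move: (zm k) (zm k.+1) (zm k.+2) (bz k) (bz k.+1) (bzE k) (bzE k.+1).
move: (pE k) (pE k.+1); rewrite ck1; case: k kk0 {ck1} => [|k] kk0.
  by rewrite z0; lia.
have ck1 : c k = 0%N by apply: ck; rewrite -kk0; lia.
by move: (zm k) (bz k) (bzE k) (pE k); rewrite ck1; lia.
Qed.

(** * Betti numbers of a pair of complexes with an acyclic matching *)

Section Morse.

Variables (F : fieldType) (d : Order.disp_t) (S : finOrderType d).
Variables (K L D : {set {set S}}) (e : {set S} -> {set S}) (phi : {set S} -> nat).
Hypotheses (cK : simplicial_complex K) (cL : simplicial_complex L).
Hypotheses (subLK : L \subset K) (subDKL : D \subset K :\: L).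
Hypothesis mD : acyclic_matching D e phi.
Implicit Types (s t : {set S}).

Definition skeleton (A : {set {set S}}) k : {set {set S}} :=
  [set s in A | #|s| == k].

Definition uppers k : {set {set S}} :=
  [set t in D | (e t \subset t) && (#|t| == k)].

Lemma dim_chains A k : \dim (chains F A k) = #|skeleton A k|.
Proof. exact: dim_simplex_span. Qed.

(* Chains of upper cells with boundary in [L] vanish: let [t] maximize [phi] in
   the support; then [t] is the only cell of the support above [t :\: e t]. *)
Lemma uppers_cycles k :
  (simplex_span F (uppers k) :&: rel_cycles F K L k = 0)%VS.
Proof.
apply/eqP; rewrite -subv0; apply/subvP => c /memv_capP[/simplex_spanP cU].
move=> /memv_capP[_]; rewrite -memv_preim => /simplex_spanP cL'.
rewrite memv0; apply: contraT => /eqP c0.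
have [t0 ct0] : exists t, c t != 0.
  apply/existsP; apply: contra_notT c0 => /existsPn nz; apply/ffunP => s.
  by rewrite ffunE; apply/eqP; have := nz s; rewrite negbK.
case: (@arg_maxnP _ t0 (fun t => c t != 0) phi ct0) => t ct tmax.
have := cU t ct; rewrite inE => /and3P[tD et _].
have [sD phis es] := matching_down mD tD.
have [x ex] := matching_singleton mD tD; rewrite ex sub1set in sD phis es et.
have sNL : t :\ x \notin L.
  by have := subsetP subDKL _ sD; rewrite inE => /andP[].
suff /cL' : boundary F S c (t :\ x) != 0 by rewrite inE (negPf sNL).
rewrite boundaryE (bigD1 t) //= big1 ?addr0 => [|u ut].
  by rewrite simplex_boundary_face // mulf_neq0 // signr_eq0.
have [->|cu] := eqVneq (c u) 0; first exact: mul0r.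
have [->|bu] := eqVneq (simplex_boundary F u (t :\ x)) 0; first exact: mulr0.
case/negP: ut; have [y yu sE] := simplex_boundary_neq0 bu.
have := cU u cu; rewrite inE => /and3P[uD eu _].
(* With [s = t :\ x], [phi s <= phi u <= phi t = phi s], so [u] is an upper cell with [e u =
   [set x]], which forces [u = t]. *)
have [|le eqe] := proj2 mD _ _ sD uD; first by rewrite sE subD1set.
have eqphi : phi (t :\ x) = phi u.
  by apply/eqP; rewrite eqn_leq le phis; apply: tmax.
have xu : x \in u by rewrite -sub1set -es eqe.
have xy : x = y.
  apply/eqP; have : x \notin u :\ y by rewrite -sE !inE eqxx.
  by rewrite !inE xu andbT negbK.
by rewrite -(setD1K et) -(setD1K xu) sE xy.
Qed.

Lemma dim_rel_cycles k :
  (\dim (rel_cycles F K L k) + #|uppers k| <= #|skeleton K k|)%N.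
Proof.
rewrite -dim_chains addnC -(dim_simplex_span F).
rewrite -(dimv_disjoint_sum (uppers_cycles k)); apply: dimvS.
rewrite subv_add capvSl andbT; apply/subvP => c /simplex_spanP cU.
apply/simplex_spanP => s /cU; rewrite !inE => /and3P[sD _ ->].
by have := subsetP subDKL _ sD; rewrite inE andbT => /andP[].
Qed.

Lemma rel_boundaries_cycles k : (rel_boundaries F K L k <= rel_cycles F K L k)%VS.
Proof.
rewrite subv_add !subv_cap (chainsS F k subLK); apply/and3P; split=> //.
  apply/andP; split; apply/subvP => _ /memv_imgP[c cC ->].
    exact: boundary_chains.
  by rewrite -memv_preim boundaryK mem0v.
apply/subvP => c cC; rewrite -memv_preim; case: k cC => [|k] cC.
  by rewrite (boundary_chains0 cC) mem0v.
exact: boundary_chains.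
Qed.

(** A face of [K] is in [L], an upper cell, a lower cell or unmatched. Adding [e s] maps the lower
    cells with [k] elements bijectively to the upper cells with [k.+1]. *)
Lemma card_skeleton k : #|skeleton K k| =
  (#|skeleton L k| + #|uppers k| + #|uppers k.+1| + #|skeleton (K :\: L :\: D) k|)%N.
Proof.
pose lowers := [set s in D | ~~ (e s \subset s) && (#|s| == k)].
have lowE s : s \in D -> ~~ (e s \subset s) -> [disjoint e s & s].
  by move=> sD; have [x ->] := matching_singleton mD sD; rewrite sub1set disjoints1.
have DK s : s \in D -> (s \in K) && (s \notin L).
  by move=> /(subsetP subDKL); rewrite inE andbC.
have lows : #|lowers| = #|uppers k.+1|.
  rewrite -(card_in_imset (f := fun s => s :|: e s) (D := lowers)).
    apply: eq_card => t; apply/imsetP/idP => [[s]|].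
      rewrite !inE => /and3P[sD es /eqP <-] ->.
      have [uD _ eu] := matching_up mD sD; rewrite uD eu subsetUr /=.
      have [x ex] := matching_singleton mD sD; rewrite ex sub1set in es *.
      by rewrite setUC cardsU1 es.
    rewrite inE => /and3P[tD et /eqP ct]; exists (t :\: e t); last first.
      have [_ _ ->] := matching_down mD tD.
      by rewrite setUC setDE setUIr setUCr setIT (setUidPr et).
    have [sD _ es] := matching_down mD tD; rewrite inE sD es.
    have [x ex] := matching_singleton mD tD; rewrite ex !sub1set in et *.
    by rewrite !inE eqxx /=; move: ct; rewrite (cardsD1 x) et add1n => -[->].
  move=> s t; rewrite !inE => /and3P[sD es _] /and3P[tD et _] E.
  have [_ _ eu] := matching_up mD sD; have [_ _ eu'] := matching_up mD tD.
  have eE : e s = e t by rewrite -eu E eu'.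
  have := congr1 (fun u => u :\: e s) E; rewrite !setDUl eE setDv !setU0.
  have /setDidPl -> : [disjoint t & e t] by rewrite disjoint_sym lowE.
  rewrite -eE.
  by have /setDidPl -> : [disjoint s & e s] by rewrite disjoint_sym lowE.
rewrite -lows -(cardsID L (skeleton K k)) -!addnA; congr (_ + _)%N.
  apply: eq_card => s; rewrite !inE; case: (boolP (s \in L)) => sL; rewrite ?andbF //.
  by rewrite (subsetP subLK) // andbT.
rewrite addnA -(cardsID D); congr (_ + _)%N; last first.
  by apply: eq_card => s; rewrite !inE !andbA.
rewrite -(cardsID [set s | e s \subset s]); congr (_ + _)%N;
  apply: eq_card => s; rewrite !inE; case: (boolP (s \in D)) => sD;
  rewrite ?andbF //= andbT; case/andP: (DK s sD) => -> -> /=; by rewrite andbC.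
Qed.

Lemma morse_rbetti k0 k :
    (forall s, s \in K :\: L :\: D -> #|s| = k0) ->
  rbetti F K L k = if k == k0 then #|K :\: L :\: D| else 0%N.
Proof.
move=> crit.
have critE j : #|skeleton (K :\: L :\: D) j| =
               if j == k0 then #|K :\: L :\: D| else 0%N.
  case: eqP => [->|jk0].
    apply: eq_card => s; rewrite inE.
    by case: (boolP (s \in _)) => //= /crit->; rewrite eqxx.
  apply/eqP; rewrite cards_eq0 -subset0; apply/subsetP => s.
  by rewrite inE => /andP[/crit sk /eqP sj]; case: jk0; rewrite -sj.
have ranks j : (\dim (rel_boundaries F K L j) + \dim (rel_cycles F K L j.+1)
              = #|skeleton K j.+1| + #|skeleton L j|)%N.
  by rewrite -!dim_chains; apply: dim_relative.
have bz j := dimvS (rel_boundaries_cycles j).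
have z0 : \dim (rel_cycles F K L 0) = #|skeleton K 0|.
  rewrite -dim_chains /rel_cycles; congr (\dim _); apply/capv_idPl/subvP => c cC.
  by rewrite -memv_preim (boundary_chains0 cC) mem0v.
rewrite -critE.
(* Here [z] and [b] are the dimensions of relative cycles and boundaries; [p], [q], [m], [c] count
   the faces of [K], the faces of [L], the upper cells and the unmatched faces. *)
apply: (tight_morse_inequalities (k0 := k0) dim_rel_cycles bz ranks z0 card_skeleton).
by move=> j jk0; rewrite critE (negPf jk0).
Qed.

End Morse.

(** * Poincare polynomials *)

(** The broken-circuit matching preserves rank, so it restricts to each rank [j]. The unmatched
    faces of rank [j] are independent and thus have [j] elements, which leaves only the terms with
    [k = j]. *)
Lemma poincare_fun_rk (d : Order.disp_t) (S : finOrderType d)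
    (C : semimatroid S) (F : fieldType) :
  poincare_fun F (faces C) (rk C) = \sum_(s in BC C) ('X * 'X%:P) ^+ #|s|.
Proof.
have BCf := @BC_faces _ _ C.
have rkBC s : s \in BC C -> rk C s = #|s|.
  by move/BC_independent; rewrite independentE => /andP[_ /eqP].
have [e [phi [mD rkd rku]]] := broken_matching C.
have bettiE j k : rbetti F (sublevel (faces C) (rk C) j)
      (strict_sublevel (faces C) (rk C) j) k
    = if k == j then #|[set s in BC C | #|s| == j]| else 0%N.
  pose D := [set s in faces C :\: BC C | rk C s == j].
  have memD s : (s \in D) = (s \in faces C :\: BC C) && (rk C s == j).
    by rewrite in_set.
  have crit : sublevel (faces C) (rk C) j
      :\: strict_sublevel (faces C) (rk C) j :\: D = [set s in BC C | #|s| == j].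
    apply/setP => s; rewrite [in RHS]in_set [in LHS]in_setD memD !in_setD.
    rewrite [s \in sublevel _ _ _]in_set [s \in strict_sublevel _ _ _]in_set.
    have [sBC|sBC] := boolP (s \in BC C).
      by rewrite BCf //= -rkBC // -leqNgt eqn_leq andbC.
    case: (s \in faces C) => //=.
    by rewrite -leqNgt [(j <= _)%N && _]andbC -eqn_leq andNb.
  have mono (s t : {set S}) : t \in faces C -> s \subset t -> (rk C s <= rk C t)%N.
    by move=> tC st; apply: rk_mono => //; apply: faces_complex tC st.
  rewrite (@morse_rbetti F _ S _ _ D e phi _ _ _ _ _ j) ?crit //.
  - move=> s t; rewrite !inE => /andP[tC tj] st.
    by rewrite (faces_complex tC st) (leq_trans (mono s t tC st)).
  - move=> s t; rewrite !inE => /andP[tC tj] st.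
    by rewrite (faces_complex tC st) (leq_ltn_trans (mono s t tC st)).
  - by apply/subsetP => s; rewrite !inE => /andP[-> /ltnW->].
  - apply/subsetP => s; rewrite inE in_setD !inE => /andP[/andP[_ ->] /eqP->].
    by rewrite ltnn leqnn.
  - apply: (matching_restrict mD); first by apply/subsetP => s; rewrite inE => /andP[].
    move=> s; rewrite !memD => /andP[sD /eqP rs].
    have [dD _ _] := matching_down mD sD; have [uD _ _] := matching_up mD sD.
    by rewrite dD uD rkd ?rku // rs eqxx.
  - by move=> s; rewrite inE => /andP[_ /eqP].
rewrite /poincare_fun.
rewrite [RHS](partition_big (fun s : {set S} => inord #|s| : 'I_#|S|.+1) predT) //=.
apply: eq_bigr => k _; under eq_bigr => j _ do rewrite bettiE.
set M := \max_(s in faces C) rk C s.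
transitivity (#|[set s in BC C | #|s| == k]|%:R
              *: ('X%:P ^+ k * 'X ^+ k) : {poly {poly int}}).
  have [kM|Mk] := ltnP k M.+1.
    rewrite (bigD1 (Ordinal kM)) //= eqxx big1 ?addr0 // => j jk.
    by case: eqP => [kj|_]; [case/eqP: jk; apply: val_inj | rewrite scale0r].
  rewrite big1 => [|j _]; last by rewrite gtn_eqF ?scale0r // (leq_trans (ltn_ord j)).
  (* Beyond the maximal rank there is nothing to count, since cardinality equals rank on [BC C]. *)
  suff -> : [set s in BC C | #|s| == k] = set0 by rewrite cards0 scale0r.
  apply/setP => s; rewrite inE in_set0; apply/andP => -[sBC /eqP sk].
  move: Mk; rewrite -sk -rkBC // ltnNge => /negP[].
  exact: (@leq_bigmax_cond _ (mem (faces C)) (rk C) s (BCf _ sBC)).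
have kE (s : {set S}) : (inord #|s| == k) = (#|s| == k :> nat).
  by rewrite -val_eqE /= inordK // ltnS max_card.
under [RHS]eq_bigl => s do rewrite kE.
rewrite (eq_bigr (fun=> 'X%:P ^+ k * 'X ^+ k)) => [|s /andP[_ /eqP->]]; last first.
  by rewrite exprMn mulrC.
rewrite sumr_const scaler_nat; congr (_ *+ _).
by apply: eq_card => s; rewrite inE.
Qed.

(** The matchings of [BC C :\: CBC C] and [faces C :\: BC C] combine because [BC C] is a complex.
    The unmatched faces form [CBC C], and all have the size of a basis. *)
Lemma poincare_faces (d : Order.disp_t) (S : finOrderType d)
    (C : semimatroid S) (F : fieldType) :
  poincare F (faces C) = \sum_(s in CBC C) 'X ^+ #|s|.
Proof.
have [B0 bB0 _] := basis_exists (independent_set0 C).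
have CBCB s : s \in CBC C -> s \in BC C by rewrite [s \in CBC C]in_set => /andP[].
have BCf := @BC_faces _ _ C.
have cardE s : s \in CBC C -> #|s| = #|B0|.
  rewrite in_set (basis_card _ bB0) => /and4P[_ _ _ /eqP //].
have [e1 [phi1 [m1 _ _]]] := broken_matching C.
have [e2 [phi2 m2]] := shelling_matching C.
have [||e [phi mD]] := matching_cat m2 m1.
- rewrite disjoints_subset; apply/subsetP => s.
  by rewrite in_setC !in_setD => /andP[_ ->].
- move=> s t; rewrite !in_setD => /andP[_ sBC] /andP[tN _].
  by apply: contra tN; apply: BC_complex.
have crit : faces C :\: set0 :\: (BC C :\: CBC C :|: faces C :\: BC C) = CBC C.
  apply/setP => s; rewrite setD0 !(in_setD, in_setU).
  have [/CBCB sBC|sN] := boolP (s \in CBC C); first by rewrite sBC BCf.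
  case: (boolP (s \in BC C)) => //= sBC; by case: (s \in faces C).
have bettiE k : rbetti F (faces C) set0 k = if k == #|B0| then #|CBC C| else 0%N.
  rewrite (@morse_rbetti F _ S _ _ _ e phi _ _ _ _ mD #|B0|) ?crit //.
  - exact: faces_complex.
  - by move=> s t; rewrite inE.
  - exact: sub0set.
  - rewrite setD0 subUset subsetDl andbT; apply/subsetP => s.
    by rewrite in_setD => /andP[_ /BCf].
have lt0 : (#|B0| < #|S|.+1)%N by rewrite ltnS max_card.
rewrite /poincare (bigD1 (Ordinal lt0)) //= big1 ?addr0 => [|k kB].
  rewrite bettiE eqxx (eq_bigr (fun=> 'X ^+ #|B0|)) => [|s /cardE-> //].
  by rewrite sumr_const scaler_nat.
rewrite bettiE; case: eqP => [kE|_]; last exact: scale0r.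
by case/eqP: kB; apply: val_inj.
Qed.

Theorem theorem4p2 (d : Order.disp_t) (S : finOrderType d)
    (C : semimatroid S) (F : fieldType) :
  [/\ collapses (faces C) (BC C),
      poincare_fun F (faces C) (rk C)
        = \sum_(s in BC C) ('X * 'X%:P) ^+ #|s|
    & poincare F (faces C) = \sum_(s in CBC C) 'X ^+ #|s|].
Proof.
split; [|exact: poincare_fun_rk|exact: poincare_faces].
have [e [phi [mD _ _]]] := broken_matching C.
have E : faces C :\: (faces C :\: BC C) = BC C.
  by rewrite setDDr setDv set0U; apply/setIidPr/subsetP => s /BC_faces.
rewrite -[BC C]E; apply: matching_collapses mD; rewrite ?E ?subsetDl //.
  exact: faces_complex.
exact: BC_complex.
Qed.
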